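(* For any equation of the form $u_{12}=F(u)$ with $F_u\ne0$, where $u=u(x)$, $x=(x_1,x_2)$, $u_{12}=\partial^2u/\partial x_1\partial x_2$ and $F$ is a smooth function of $u$, there exists a one-to-one correspondence between its solutions and its reduction operators of the form $Q=\partial_2+\zeta(x)\partial_u$ (resp. $Q^*=\partial_1+\zeta^*(x)\partial_u$). Namely, each operator of this kind is of singularity co-order $0$ and corresponds to the solution which is invariant with respect to this operator. (Thus solving the equation and the exhaustive description of its reduction operators of the form $Q=\partial_2+\zeta(x)\partial_u$ (resp. $Q^*=\partial_1+\zeta^*(x)\partial_u$) are completely equivalent problems.)
   Context: All considerations are local; functions are smooth; $\partial_i=\partial/\partial x_i$, and $F_u\ne0$ means that $F_u$ does not vanish on the domain considered (so $F$ is locally invertible). For a vector field $Q=\xi^1\partial_1+\xi^2\partial_2+\eta\partial_u$ (coefficients functions of $(x,u)$, $(\xi^1,\xi^2)\ne(0,0)$) put $Q[u]=\eta-\xi^1u_1-\xi^2u_2$, and let $\mathcal Q_{(2)}$ be the submanifold of the second-order jet space defined by $Q[u]=0$, $D_1Q[u]=0$, $D_2Q[u]=0$, where $D_i$ are the total derivatives. A function $u=f(x)$ is $Q$-invariant if it solves $Q[u]=0$. With $L=u_{12}-F(u)$, $Q$ is a reduction operator of the equation $L=0$ if the second prolongation of $Q$ applied to $L$ vanishes on $\{L=0\}\cap\mathcal Q_{(2)}$; in the local setting this intersection is taken to be nonempty (so that, for $Q=\partial_2+\zeta(x)\partial_u$, the equation $\zeta_1=F(u)$ arising on it can be solved for $u$).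 The singularity co-order of $Q$ for $L$ is the minimal order of differential functions $\tilde L$ (functions of $x$, $u$ and derivatives of $u$) such that $L|_{\mathcal Q_{(2)}}=\tilde L|_{\mathcal Q_{(2)}}$ (order $0$ means a function of $x$ and $u$ only, not identically zero; the zero function has order $-1$). *)

(* Defs.v *)
From HB Require Import structures.
From mathcomp Require Import all_boot all_order all_algebra.
From mathcomp Require Import all_classical all_reals all_analysis.
Import Order.TTheory GRing.Theory Num.Theory.
Import numFieldNormedType.Exports.

Set Implicit Arguments.
Unset Strict Implicit.
Unset Printing Implicit Defensive.

Local Open Scope classical_set_scope.
Local Open Scope ring_scope.

Section Smooth.
Context {R : realType}.

Definition pderiv (n : nat) (i : 'I_n) (f : 'rV[R]_n -> R) : 'rV[R]_n -> R :=
  fun x => 'D_(delta_mx 0 i) f x.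

(* C^oo on an open set A: every iterated partial derivative is (Frechet)
   differentiable, hence continuous, at every point of A. *)
Definition smooth_on (n : nat) (A : set 'rV[R]_n) (f : 'rV[R]_n -> R) : Prop :=
  forall (s : seq 'I_n) (x : 'rV[R]_n), A x ->
    differentiable (foldr (@pderiv n) f s) x.

Definition smooth1_on (A : set R) (F : R -> R) : Prop :=
  forall (n : nat) (u : R), A u -> derivable (F^`(n))%classic u 1.

End Smooth.

(* Coordinates (numbered from 0) on the second-order jet space over the
   (x_1, x_2, u)-space:
     0    1    2  3    4    5     6     7
     x_1  x_2  u  u_1  u_2  u_11  u_12  u_22
   The indices i, j : 'I_2 of the independent variables are also numbered from
   0, so that ord0 stands for x_1 and ord_max for x_2; u_12 = u_21 is a single
   coordinate, given by both cu2 ord0 ord_max and cu2 ord_max ord0. *)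
Definition cx (i : 'I_2) : 'I_8 := inord i.
Definition cu : 'I_8 := inord 2.
Definition cu1 (i : 'I_2) : 'I_8 := inord (3 + i).
Definition cu2 (i j : 'I_2) : 'I_8 := inord (5 + i + j).

(* order, as a derivative of u, of the k-th jet coordinate (0 for x_1, x_2, u) *)
Definition coord_order (k : 'I_8) : nat :=
  nth 0%N [:: 0; 0; 0; 1; 1; 2; 2; 2]%N k.

Section Jets.
Context {R : realType}.

Definition jet := 'rV[R]_8.

(* projections (x_1, x_2, u, ...) |-> (x_1, x_2, u) and
   (x_1, x_2, u) |-> (x_1, x_2) *)
Definition jet_base (p : jet) : 'rV[R]_3 :=
  \row_(i < 3) p 0 (widen_ord (isT : 3 <= 8)%N i).
Definition base_x (y : 'rV[R]_3) : 'rV[R]_2 :=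
  \row_(i < 2) y 0 (widen_ord (isT : 2 <= 3)%N i).

Definition base_dom (Omega : set 'rV[R]_2) (J : set R) : set 'rV[R]_3 :=
  [set y | Omega (base_x y) /\ J (y 0 ord_max)].
Definition jet_dom (Omega : set 'rV[R]_2) (J : set R) : set jet :=
  [set p | base_dom Omega J (jet_base p)].

Definition jet2 (f : 'rV[R]_2 -> R) (x : 'rV[R]_2) : jet :=
  \row_(k < 8) [:: x 0 ord0; x 0 ord_max; f x;
                   pderiv ord0 f x; pderiv ord_max f x;
                   pderiv ord0 (pderiv ord0 f) x;
                   pderiv ord0 (pderiv ord_max f) x;
                   pderiv ord_max (pderiv ord_max f) x]`_k.

(* Total derivative D_i of a differential function G of order at most one;
   the terms u_{ijk} dG/du_{jk} of the general formula are absent for such G,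
   and D_i is only ever applied to such G below. *)
Definition Dtot (i : 'I_2) (G : jet -> R) : jet -> R := fun p =>
  pderiv (cx i) G p + p 0 (cu1 i) * pderiv cu G p
  + \sum_(j < 2) p 0 (cu2 i j) * pderiv (cu1 j) G p.

(* Q = \sum_i xi^i(x, u) d/dx_i + eta(x, u) d/du *)
Record vfield := VField {
  vf_xi : 'I_2 -> 'rV[R]_3 -> R;
  vf_eta : 'rV[R]_3 -> R }.

(* d/dx_i + zeta(x) d/du *)
Definition vf_shift (i : 'I_2) (zeta : 'rV[R]_2 -> R) : vfield :=
  VField (fun j _ => (j == i)%:R) (zeta \o base_x).

(* Q[u] = eta - xi^1 u_1 - xi^2 u_2 *)
Definition vf_char (Q : vfield) : jet -> R := fun p =>
  vf_eta Q (jet_base p) - \sum_(i < 2) vf_xi Q i (jet_base p) * p 0 (cu1 i).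

(* the submanifold Q_(2) *)
Definition char_manifold (Q : vfield) : set jet :=
  [set p | vf_char Q p = 0 /\ forall i : 'I_2, Dtot i (vf_char Q) p = 0].

(* coefficients of the second prolongation of Q:
     eta^i = D_i eta - \sum_k u_k D_i xi^k,
     eta^{ij} = D_j eta^i - \sum_k u_{ik} D_j xi^k *)
Definition prol1 (Q : vfield) (i : 'I_2) : jet -> R := fun p =>
  Dtot i (vf_eta Q \o jet_base) p
  - \sum_(k < 2) p 0 (cu1 k) * Dtot i (vf_xi Q k \o jet_base) p.
Definition prol2 (Q : vfield) (i j : 'I_2) : jet -> R := fun p =>
  Dtot j (prol1 Q i) p
  - \sum_(k < 2) p 0 (cu2 i k) * Dtot j (vf_xi Q k \o jet_base) p.

(* The second prolongation of Q applied to L; each of the coordinates u_11,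
   u_12, u_22 contributes once. *)
Definition prolong (Q : vfield) (L : jet -> R) : jet -> R := fun p =>
  \sum_(i < 2) vf_xi Q i (jet_base p) * pderiv (cx i) L p
  + vf_eta Q (jet_base p) * pderiv cu L p
  + \sum_(i < 2) prol1 Q i p * pderiv (cu1 i) L p
  + \sum_(i < 2) \sum_(j < 2 | (i <= j)%N) prol2 Q i j p * pderiv (cu2 i j) L p.

Definition solution (Omega : set 'rV[R]_2) (J : set R) (L : jet -> R)
    (f : 'rV[R]_2 -> R) : Prop :=
  smooth_on Omega f /\
  forall x, Omega x -> J (f x) /\ L (jet2 f x) = 0.

Definition invariant_fun (Omega : set 'rV[R]_2) (Q : vfield)
    (f : 'rV[R]_2 -> R) : Prop :=
  forall x, Omega x -> vf_char Q (jet2 f x) = 0.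

(* Q is a vector field on Omega x J. In the third item, nonemptiness of
   {L = 0} /\ Q_(2) is asked over every point x of Omega: the equations that
   arise on this intersection can be solved for u throughout Omega (near the
   base point of an element of the intersection, this is a matter of
   shrinking Omega). *)
Definition reduction_operator (Omega : set 'rV[R]_2) (J : set R)
    (L : jet -> R) (Q : vfield) : Prop :=
  [/\ smooth_on (base_dom Omega J) (vf_eta Q) /\
        (forall i, smooth_on (base_dom Omega J) (vf_xi Q i)),
      forall y, base_dom Omega J y -> exists i, vf_xi Q i y != 0,
      forall x, Omega x -> exists p, [/\ jet_dom Omega J p,
        base_x (jet_base p) = x, L p = 0 & char_manifold Q p] &
      forall p, jet_dom Omega J p -> L p = 0 -> char_manifold Q p ->
        prolong Q L p = 0].

(* G, as a differential function on D, has order at most r; for negative r this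
   means G = 0. *)
Definition order_le (D : set jet) (G : jet -> R) (r : int) : Prop :=
  match r with
  | Posz n => forall p q, D p -> D q ->
      (forall k, (coord_order k <= n)%N -> p 0 k = q 0 k) -> G p = G q
  | Negz _ => forall p, D p -> G p = 0
  end.

Definition has_order (D : set jet) (G : jet -> R) (r : int) : Prop :=
  [/\ -1 <= r, order_le D G r &
      forall s : int, -1 <= s -> s < r -> ~ order_le D G s].

(* r is the minimal order of the differential functions that coincide with L on
   Q_(2). Functions on the second-order jet space suffice, as L is one. *)
Definition singularity_coorder (Omega : set 'rV[R]_2) (J : set R)
    (L : jet -> R) (Q : vfield) (r : int) : Prop :=
  let D := jet_dom Omega J in
  let candidate (G : jet -> R) (s : int) :=
    [/\ smooth_on D G, has_order D G s &
        forall p, D p -> char_manifold Q p -> L p = G p] in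
  (exists G, candidate G r) /\ (forall G s, candidate G s -> r <= s).

(* L = u_12 - F(u) *)
Definition wave_eq (F : R -> R) : jet -> R :=
  fun p => p 0 (cu2 ord0 ord_max) - F (p 0 cu).

End Jets.

Arguments jet : clear implicits.
Arguments vfield : clear implicits.

(* Main.v *)
(* On Q_(2) for Q = d/dx_i + zeta(x) d/du, with o the other index, the equation
   becomes zeta_o(x) = F(u), and the reduction condition becomes
   zeta_{oi}(x) = zeta(x) F'(u) wherever zeta_o(x) = F(u). As F is injective on
   J, zeta_o = F(u) has a unique solution u = f(x), smooth because F' does not
   vanish. Differentiating F(f) = zeta_o in x_i turns the reduction condition
   into f_i = zeta, and then f_{io} = zeta_o = F(f). Conversely zeta = f_i works
   for any solution f. Finally, zeta_o(x) - F(u) is a function of (x, u) that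
   coincides with L on Q_(2) and depends on u, so the co-order is 0. *)
Require Import Defs.
From mathcomp Require Import all_boot all_order all_algebra.
From mathcomp Require Import all_classical all_reals all_analysis.
From mathcomp Require Import lra ring zify.
Import Order.TTheory GRing.Theory Num.Theory.
Import numFieldNormedType.Exports.

Local Open Scope classical_set_scope.
Local Open Scope ring_scope.

(** * Local nature of differentiability and derivatives along linear maps *)

Section Calculus.
Set Implicit Arguments.
Unset Strict Implicit.
Unset Printing Implicit Defensive.
Context {R : realType}.

Lemma near0_shift (V : normedModType R) (P : set V) (x : V) :
  (\forall y \near x, P y) -> \forall h \near 0, P (h + x).
Proof.
rewrite (near_shift 0 x)/= => Px; near=> h.
by rewrite -[x in _ + x]subr0; near: h.
Unshelve. all: by end_near. Qed.

(** The first-order expansion of [f] at [x] is also one for [g]. By uniqueness of the differential,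
    ['d g x] is then ['d f x], and its continuity is inherited. *)
Lemma near_eq_differentiable (V W : normedModType R) (f g : V -> W) (x : V) :
  {near x, f =1 g} -> differentiable f x -> differentiable g x.
Proof.
move=> fg fx; have [df fE] := (diff_locallyP x f).1 fx.
have gE : g \o shift x = cst (g x) + 'd f x +o_ 0 id.
  apply/eqaddoP => e e0; have /eqaddoP/(_ e e0) := fE.
  apply: filterS2 (near0_shift fg) => h /= fgh.
  rewrite -![(_ + _ : _ -> _) _]/(_ + _) -![(- _ : _ -> _) _]/(- _) /=.
  by rewrite fgh (nbhs_singleton fg).
have dgE := diff_unique df gE.
by apply/diff_locallyP; rewrite dgE.
Qed.

(** The Frechet expansion in epsilon form, uniform in the direction of [h]; this uniformity is what
    [second_difference] relies on. *)
Lemma differentiable_near (V : normedModType R) (f : V -> R) (x : V) :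
  differentiable f x -> forall e, 0 < e ->
  \forall h \near 0, `|f (h + x) - f x - 'D_h f x| <= e * `|h|.
Proof.
move=> fx e e0; have [_ /eqaddoP/(_ e e0)] := (diff_locallyP x f).1 fx.
apply: filterS => h; rewrite deriveE// /cst.
rewrite -![(_ + _ : _ -> _) _]/(_ + _) -![(- _ : _ -> _) _]/(- _) /=.
by rewrite opprD addrA.
Qed.

(** The difference quotients on both sides are the same function of the increment, so their limits
    agree for an arbitrary [g]. *)
Lemma derive_comp_linear (V W X : normedModType R) (f : {linear V -> W})
    (g : W -> X) (x v : V) :
  'D_v (g \o f) x = 'D_(f v) g (f x).
Proof.
rewrite /derive; congr (lim (_ @ 0^')); apply/funext => h /=.
by rewrite linearP.
Qed.


Lemma colsub_continuous m n p (s : 'I_p -> 'I_n) :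
  continuous (colsub s : 'M[R]_(m, n) -> 'M[R]_(m, p)).
Proof.
move=> u A /nbhs_ballP[e /= e0 eA].
apply/nbhs_ballP; exists e => //= v [_ uv]; apply: eA; split => // i j.
by rewrite !mxE.
Qed.

Lemma differentiable_mulmxr m n (M : 'M[R]_(m, n)) (x : 'rV[R]_m) :
  differentiable (mulmxr M : 'rV[R]_m -> 'rV[R]_n) x.
Proof.
have -> : (mulmxr M : 'rV[R]_m -> 'rV[R]_n) =
    \sum_(i < m) (fun x : 'rV[R]_m => x 0 i *: row i M).
  by apply/funext => y; rewrite fct_sumE /= mulmx_sum_row.
apply: differentiable_sum => i.
exact/differentiableZl/differentiable_coord.
Qed.

(** * Functions of class C^k and their closure properties *)

Section Ck.
Context {n : nat}.
Implicit Types (A : set 'rV[R]_n) (f g : 'rV[R]_n -> R).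

(* A bounded-order version of smooth_on, peeling derivatives off from the
   inside: the order allows the bootstrap in smooth_on_local_inverse. *)
Fixpoint Ck (k : nat) A f : Prop :=
  (forall x, A x -> differentiable f x) /\
  if k is l.+1 then forall i, Ck l A (pderiv i f) else True.

Lemma Ck_differentiable k A f x : Ck k A f -> A x -> differentiable f x.
Proof. by case: k => [|k] [+ _]; exact. Qed.

Lemma Ck_pred k A f : Ck k.+1 A f -> Ck k A f.
Proof.
elim: k f => [f [df _]|k IH f [df Df]]; first by split.
by split=> // i; exact/IH/Df.
Qed.

Lemma smooth_onP A f : smooth_on A f <-> forall k, Ck k A f.
Proof.
split=> [sf k|Cf s x Ax].
  elim: k f sf => [|k IH] f sf.
    by split=> // x; exact: (sf [::]).
  split=> [|i]; first by move=> x; exact: (sf [::]).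
  apply: IH => s x Ax; have := sf (rcons s i) x Ax.
  by rewrite -cats1 foldr_cat.
(* The last element of [s] is the innermost derivative, the one that [Ck] peels off first; hence the
   induction from the right. *)
have {Cf} := Cf (size s); elim/last_ind: s f => [f [df _]|s i IH f].
  exact: df.
rewrite size_rcons -cats1 foldr_cat => -[_ Df]; exact/IH/Df.
Qed.

Lemma smooth_on_pderiv A f i : smooth_on A f -> smooth_on A (pderiv i f).
Proof. by move=> /smooth_onP sf; apply/smooth_onP => k; have [_] := sf k.+1; exact. Qed.

Lemma smooth_on_differentiable A f x : smooth_on A f -> A x -> differentiable f x.
Proof. by move=> sf; exact: (sf [::]). Qed.

Lemma pderivM f g i x : differentiable f x -> differentiable g x ->
  pderiv i (f \* g) x = f x * pderiv i g x + g x * pderiv i f x.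
Proof. by move=> fx gx; rewrite /pderiv deriveM//; exact: diff_derivable. Qed.

Lemma pderivD f g i x : differentiable f x -> differentiable g x ->
  pderiv i (f \+ g) x = pderiv i f x + pderiv i g x.
Proof. by move=> fx gx; rewrite /pderiv deriveD//; exact: diff_derivable. Qed.

Lemma pderivN f i x : differentiable f x ->
  pderiv i (\- f) x = - pderiv i f x.
Proof. by move=> fx; rewrite /pderiv deriveN//; exact: diff_derivable. Qed.

Lemma pderivV f i x : differentiable f x -> f x != 0 ->
  pderiv i (fun y => (f y)^-1) x = - (f x)^-2 * pderiv i f x.
Proof. by move=> fx f0; rewrite /pderiv deriveV//; exact: diff_derivable. Qed.

Lemma pderiv_comp1 (h : R -> R) f i x : derivable h (f x) 1 ->
  differentiable f x -> pderiv i (h \o f) x = h^`()%classic (f x) * pderiv i f x.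
Proof.
move=> hfx fx; have dh := (derivable1_diffP _ _).1 hfx.
rewrite /pderiv !deriveE//; last exact: differentiable_comp.
by rewrite diff_comp//= deriv1E// mulrC.
Qed.

Section open_domain.
Context {A : set 'rV[R]_n} (oA : open A).

Lemma pderiv_eq_on f g i x : (forall y, A y -> f y = g y) -> A x ->
  pderiv i f x = pderiv i g x.
Proof.
move=> fg Ax; apply: near_eq_derive.
by apply: filterS fg _; exact: open_nbhs_nbhs.
Qed.

(** As [A] is open, equality on [A] is equality near each point of [A] and passes to derivatives of
    every order. The rules of differentiation below hold only on [A], and this lemma lets them be
    used as if they were equalities of functions. *)
Lemma Ck_eq k f g : (forall x, A x -> f x = g x) -> Ck k A f -> Ck k A g.
Proof.
have near_fg f' g' : (forall x, A x -> f' x = g' x) ->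
    (forall x, A x -> differentiable f' x) ->
    (forall x, A x -> differentiable g' x).
  move=> fg df x Ax; apply: near_eq_differentiable (df _ Ax).
  by apply: filterS fg _; exact: open_nbhs_nbhs.
elim: k f g => [|k IH] f g fg [df Df].
  by split=> //; exact: near_fg df.
split=> [|i]; first exact: near_fg df.
by apply: IH (Df i) => x Ax; exact: pderiv_eq_on.
Qed.

Lemma Ck_cst k c : Ck k A (cst c).
Proof.
elim: k c => [|k IH] c; first by split => // x _; exact: differentiable_cst.
split=> [x _|i]; first exact: differentiable_cst.
by apply: Ck_eq (IH 0) => x _; rewrite /pderiv derive_cst.
Qed.

Lemma CkD k f g : Ck k A f -> Ck k A g -> Ck k A (f \+ g).
Proof.
elim: k f g => [|k IH] f g [df Df] [dg Dg].
  by split=> // x Ax; exact: differentiableD (df _ Ax) (dg _ Ax).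
split=> [x Ax|i]; first exact: differentiableD (df _ Ax) (dg _ Ax).
apply: Ck_eq (IH _ _ (Df i) (Dg i)) => x Ax.
by rewrite (pderivD _ (df _ Ax) (dg _ Ax)).
Qed.

Lemma CkN k f : Ck k A f -> Ck k A (\- f).
Proof.
elim: k f => [|k IH] f [df Df].
  by split=> // x Ax; exact: differentiableN (df _ Ax).
split=> [x Ax|i]; first exact: differentiableN (df _ Ax).
by apply: Ck_eq (IH _ (Df i)) => x Ax; rewrite (pderivN _ (df _ Ax)).
Qed.

Lemma CkM k f g : Ck k A f -> Ck k A g -> Ck k A (f \* g).
Proof.
elim: k f g => [|k IH] f g Cf Cg.
  split=> // x Ax.
  exact: differentiableM (Ck_differentiable Cf Ax) (Ck_differentiable Cg Ax).
split=> [x Ax|i].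
  exact: differentiableM (Ck_differentiable Cf Ax) (Ck_differentiable Cg Ax).
have [[_ Df] [_ Dg]] := (Cf, Cg).
apply: (@Ck_eq _ ((f \* pderiv i g) \+ (g \* pderiv i f))) => [x Ax|].
  by rewrite (pderivM _ (Ck_differentiable Cf Ax) (Ck_differentiable Cg Ax)).
exact: CkD (IH _ _ (Ck_pred Cf) (Dg i)) (IH _ _ (Ck_pred Cg) (Df i)).
Qed.

(** Induction through (1/f)_i = - (1/f)^2 f_i, where 1/f on the right is only needed one order
    lower. *)
Lemma CkV k f : (forall x, A x -> f x != 0) -> Ck k A f ->
  Ck k A (fun x => (f x)^-1).
Proof.
move=> f0; elim: k => [|k IH] Cf.
  by split=> // x Ax; exact: differentiableV (Ck_differentiable Cf Ax) (f0 _ Ax).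
split=> [x Ax|i].
  exact: differentiableV (Ck_differentiable Cf Ax) (f0 _ Ax).
have Cf1 := IH (Ck_pred Cf); have [_ Df] := Cf.
pose V x := (f x)^-1.
apply: (@Ck_eq _ ((\- (V \* V)) \* pderiv i f)) => [x Ax|].
  by rewrite (pderivV _ (Ck_differentiable Cf Ax) (f0 _ Ax))/= /V -expr2 exprVn.
exact: CkM (CkN (CkM Cf1 Cf1)) (Df i).
Qed.

(** Induction through (h o f)_i = (h' o f) f_i, for all [h] at once because the step applies the
    hypothesis to h'. *)
Lemma Ck_comp1 k (J : set R) (h : R -> R) f : smooth1_on J h ->
  (forall x, A x -> J (f x)) -> Ck k A f -> Ck k A (h \o f).
Proof.
move=> + Jf; have dh h' : smooth1_on J h' -> forall x, A x -> differentiable h' (f x).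
  by move=> sh x Ax; apply/derivable1_diffP; exact: (sh 0%N _ (Jf _ Ax)).
elim: k h => [|k IH] h sh Cf.
  split=> // x Ax; exact: differentiable_comp (Ck_differentiable Cf Ax) (dh _ sh _ Ax).
split=> [x Ax|i].
  exact: differentiable_comp (Ck_differentiable Cf Ax) (dh _ sh _ Ax).
have [_ Df] := Cf.
apply: (@Ck_eq _ ((h^`()%classic \o f) \* pderiv i f)) => [x Ax|].
  rewrite pderiv_comp1//; last exact: Ck_differentiable Cf Ax.
  exact: (sh 0%N _ (Jf _ Ax)).
apply: CkM (Df i); apply: IH (Ck_pred Cf).
by move=> m u Ju; rewrite -derive1Sn; exact: sh.
Qed.

End open_domain.
End Ck.

(** * Symmetry of second derivatives *)

Section Schwarz.
Context {V : normedModType R}.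
Implicit Types (f : V -> R) (a b v w : V).

Lemma is_derive_line f b v (t : R) : derivable f (t *: v + b) v ->
  is_derive t 1 (fun s : R => f (s *: v + b)) ('D_v f (t *: v + b)).
Proof.
have -> : 'D_v f (t *: v + b) = 'D_1 (fun s : R => f (s *: v + b)) t.
  rewrite /derive; congr (lim (_ @ 0^')); apply/funext => h /=.
  by rewrite -[h *: (1 : R)]/(h * 1) mulr1 scalerDl addrA.
move=> fv; apply/derivableP; move: fv; rewrite /derivable.
set g := (X in cvg (X @ _) -> _); set k := (X in _ -> cvg (X @ _)).
suff -> : k = g by [].
apply/funext => h; rewrite /k /g /=.
by rewrite -[h *: (1 : R)]/(h * 1) mulr1 scalerDl addrA.
Qed.

(** The second difference over the parallelogram spanned by [h *: v] and [h *: w] is symmetric in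
    [v] and [w] up to reordering, which is what [schwarz] exploits. Differentiability of ['D_v f] at
    the single point [a] suffices, since both of its values that occur are expanded at [a]. *)
Lemma second_difference f a v w :
  (\forall y \near a, differentiable f y) -> differentiable ('D_v f) a ->
  forall e, 0 < e -> \forall h \near 0^'+,
    `|f (h *: v + (h *: w + a)) - f (h *: w + a) - f (h *: v + a) + f a
      - h ^+ 2 * 'D_w ('D_v f) a| <= e * h ^+ 2.
Proof.
move=> df dg e e0; set g := 'D_v f.
(* The two expansion errors are bounded by multiples of h (|v| + |w|) and h |v|, whose sum is at
   most h c; the extra 1 makes [c] positive. *)
pose c := 2 * `|v| + `|w| + 1.
have c0 : 0 < c by rewrite /c; have := normr_ge0 v; have := normr_ge0 w; lra.
have ec0 : 0 < e / c by exact: divr_gt0.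
have [d /= d0 dP] := (nbhs_normP _ _).1
  (filterI (near0_shift df) (differentiable_near dg ec0)).
have {}dP y : `|y| < d -> differentiable f (y + a) /\
    `|g (y + a) - g a - 'D_y g a| <= e / c * `|y|.
  by move=> yd; apply: dP; rewrite /ball_/= sub0r normrN.
near=> h.
have h0 : 0 < h by near: h; exact: nbhs_right_gt.
have hd : h < d / c by near: h; apply: nbhs_right_lt; exact: divr_gt0.
have hcd : h * c < d by rewrite -ltr_pdivlMr.
have small s : 0 <= s -> s <= h -> `|s *: v| < d /\ `|s *: v + h *: w| < d.
  move=> s0 sh; have sv : s * `|v| <= h * `|v| by apply: ler_wpM2r.
  have vw : h * (`|v| + `|w|) < d.
    apply: le_lt_trans hcd; rewrite ler_pM2l//.
    by rewrite /c; have := normr_ge0 v; lra.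
  have hw : 0 <= h * `|w| by rewrite mulr_ge0// ltW.
  split; first by rewrite normrZ (ger0_norm s0); lra.
  apply: le_lt_trans (ler_normD _ _) _.
  by rewrite !normrZ (ger0_norm s0) (gtr0_norm h0); lra.
(* The mean value theorem is applied to phi, then 'D_v f is linearized at a. *)
pose phi (s : R) := f (s *: v + (h *: w + a)) - f (s *: v + a).
have dphi (s : R) : 0 <= s -> s <= h ->
    is_derive s 1 phi (g (s *: v + (h *: w + a)) - g (s *: v + a)).
  move=> s0 sh; have [sv svw] := small s s0 sh.
  apply: is_deriveB; apply: is_derive_line; apply: diff_derivable.
    by rewrite addrA; exact: (dP _ svw).1.
  exact: (dP _ sv).1.
pose phi' (s : R) := g (s *: v + (h *: w + a)) - g (s *: v + a).
have [s||s] := @MVT R phi phi' 0 h h0.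
- by rewrite in_itv/= => /andP[s0 sh]; exact: dphi (ltW s0) (ltW sh).
- apply: derivable_within_continuous => s; rewrite in_itv/= => /andP[s0 sh].
  by case: (dphi _ s0 sh).
rewrite in_itv/= => /andP[s0 sh]; rewrite /phi /phi' !scale0r !add0r subr0 => phiE.
have [sv svw] := small s (ltW s0) (ltW sh).
have [_ g1] := dP _ sv; have [_ g2] := dP _ svw.
have Dlin : 'D_(s *: v + h *: w) g a = 'D_(s *: v) g a + h * 'D_w g a.
  by rewrite !deriveE// linearD [in 'd g a (h *: w)]linearZ.
have n1 : `|s *: v| <= h * `|v|.
  by rewrite normrZ gtr0_norm//; apply: ler_wpM2r => //; exact: ltW.
have n2 : `|s *: v + h *: w| <= h * (`|v| + `|w|).
  apply: le_trans (ler_normD _ _) _; rewrite mulrDr lerD//.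
  by rewrite normrZ gtr0_norm.
rewrite [s *: v + (h *: w + a)]addrA in phiE.
have -> : f (h *: v + (h *: w + a)) - f (h *: w + a) - f (h *: v + a) + f a =
    h * (g (s *: v + h *: w + a) - g (s *: v + a)) 
  by rewrite mulrC -phiE; clear; move: (f _) (f _) (f _) (f _) => *; ring.
(* By linearity of the differential, the contributions of [s *: v] cancel, and a difference of two
   expansion errors at [a] is left. *)
have -> : h * (g (s *: v + h *: w + a) - g (s *: v + a)) - h ^+ 2 * 'D_w g a =
    h * ((g (s *: v + h *: w + a) - g a - 'D_(s *: v + h *: w) g a) -
      (g (s *: v + a) - g a - 'D_(s *: v) g a)) 
  by rewrite Dlin; clear; move: (g _) (g _) (g _) ('D__ g a) ('D__ g a) => *; ring.
rewrite normrM gtr0_norm// [e * _]mulrC expr2 -mulrA ler_pM2l//.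
apply: le_trans (ler_normB _ _) _; apply: le_trans (lerD g2 g1) _.
rewrite -mulrDr; apply: (@le_trans _ _ (e / c * (h * c))).
  rewrite ler_pM2l//; have -> : h * c = h * (`|v| + `|w|) + h * `|v| + h.
    by rewrite /c; clear; ring.
  by rewrite -[X in X <= _]addr0; apply: lerD (lerD n2 n1) (ltW h0).
by rewrite mulrCA divfK ?gt_eqF.
Unshelve. all: by end_near. Qed.

(** Both mixed derivatives times h^2 approximate the same second difference within (e/2) h^2, so
    they differ by at most [e], for every [e > 0]. *)
Lemma schwarz f a v w : (\forall y \near a, differentiable f y) ->
  differentiable ('D_v f) a -> differentiable ('D_w f) a ->
  'D_w ('D_v f) a = 'D_v ('D_w f) a.
Proof.
move=> df dv dw; apply/eqP; rewrite -subr_eq0 -normr_le0; apply/ler_addgt0Pl => e e0.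
rewrite addr0; have e20 : 0 < e / 2 by lra.
have [h [[h1 h2] h0]] := filter_ex (filterI (filterI
  (second_difference w df dv e20) (second_difference v df dw e20)) (nbhs_right_gt 0)).
have h20 : 0 < h ^+ 2 by exact: exprn_gt0.
(* Identifies the far corner of the parallelogram in the two estimates. *)
rewrite addrCA in h2.
rewrite -(ler_pM2l h20) -[X in X * `|_|]gtr0_norm// -normrM.
move: h1 h2; set X := f _; set D1 := 'D_w _ _; set D2 := 'D_v _ _.
set Y := f (h *: w + a); set Z := f (h *: v + a) => h1 h2.
have -> : h ^+ 2 * (D1 - D2) = (X - Z - Y + f a - h ^+ 2 * D2) -
  (X - Y - Z + f a - h ^+ 2 * D1) by ring.
apply: le_trans (ler_normB _ _) (le_trans (lerD h2 h1) _).
by rewrite -mulrDl -splitr mulrC.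
Qed.

End Schwarz.

Lemma smooth_on_pderivC n (A : set 'rV[R]_n) (f : 'rV[R]_n -> R) i j x :
  open A -> smooth_on A f -> A x ->
  pderiv i (pderiv j f) x = pderiv j (pderiv i f) x.
Proof.
move=> oA sf Ax; apply: schwarz.
- have /= := open_nbhs_nbhs (conj oA Ax); apply: filterS => y.
  exact: smooth_on_differentiable.
- exact: smooth_on_differentiable (smooth_on_pderiv j sf) Ax.
- exact: smooth_on_differentiable (smooth_on_pderiv i sf) Ax.
Qed.

(** * Functions pulled back along a projection onto some of the coordinates *)

Section colsub.
Context {n p : nat} {s : 'I_p -> 'I_n} (s_inj : injective s).
Implicit Types (f : 'rV[R]_p -> R).

Lemma colsub_delta_mx j : colsub s (delta_mx 0 (s j)) = delta_mx 0 j :> 'rV[R]_p.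
Proof. by apply/rowP => k; rewrite !mxE/= (inj_eq s_inj). Qed.

Lemma pderiv_colsub f j :
  pderiv (s j) (f \o colsub s) = pderiv j f \o colsub s.
Proof.
by apply/funext => x; rewrite /pderiv derive_comp_linear/= colsub_delta_mx.
Qed.

Lemma pderiv_colsub0 f i : (forall j, s j != i) ->
  pderiv i (f \o colsub s) = cst 0.
Proof.
move=> si; apply/funext => x; rewrite /pderiv derive_comp_linear/=.
have -> : colsub s (delta_mx 0 i) = 0 :> 'rV[R]_p.
  by apply/rowP => k; rewrite !mxE/= (negbTE (si k)).
by rewrite derive0.
Qed.

Lemma differentiable_colsub x :
  differentiable (colsub s : 'rV[R]_n -> 'rV[R]_p) x.
Proof. exact/linear_differentiable/colsub_continuous. Qed.

(** Each partial derivative of a pullback is either the pullback of a partial derivative or zero. *)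
Lemma Ck_colsub k (A : set 'rV[R]_n) (B : set 'rV[R]_p) f : open A ->
  (forall x, A x -> B (colsub s x)) -> Ck k B f -> Ck k A (f \o colsub s).
Proof.
move=> oA AB; have dcomp g : (forall y, B y -> differentiable g y) ->
    forall x, A x -> differentiable (g \o colsub s) x.
  move=> dg x Ax; apply: differentiable_comp (differentiable_colsub x) _.
  exact: dg (AB _ Ax).
elim: k f => [|k IH] f [df Df]; first by split=> //; exact: dcomp.
split=> [|i]; first exact: dcomp.
have [[j <-]|si] := pselect (exists j, s j = i).
  by rewrite pderiv_colsub; exact: IH (Df j).
have {}si j : s j != i by apply/eqP => sj; apply: si; exists j.
by rewrite (pderiv_colsub0 _ si); exact: Ck_cst oA _ _.
Qed.

(** A section [t] of the projection recovers [f] from its pullback. It serves only for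
    differentiability; the partial derivatives come from [pderiv_colsub], so [t] is merely assumed
    differentiable. *)
Lemma Ck_colsub_inv k (A : set 'rV[R]_n) (B : set 'rV[R]_p)
    (t : 'rV[R]_p -> 'rV[R]_n) f :
  (forall y, differentiable t y) -> cancel t (colsub s) ->
  (forall y, B y -> A (t y)) -> Ck k A (f \o colsub s) -> Ck k B f.
Proof.
move=> dt tK BA; have dcomp g : (forall x, A x -> differentiable (g \o colsub s) x) ->
    forall y, B y -> differentiable g y.
  move=> dg y By; rewrite (_ : g = (g \o colsub s) \o t); last first.
    by apply/funext => z /=; rewrite tK.
  exact: differentiable_comp (dt y) (dg _ (BA _ By)).
elim: k f => [|k IH] f [df Df]; first by split=> //; exact: dcomp.
split=> [|j]; first exact: dcomp.
by apply: IH; rewrite -pderiv_colsub; exact: Df.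
Qed.

End colsub.

(** * Smooth solvability of F(f) = g for f *)

Section local_inverse.
Context {J : set R} {F : R -> R}.
Hypotheses (oJ : open J) (iJ : is_interval J) (sF : smooth1_on J F).
Hypothesis F'0 : forall u, J u -> F^`()%classic u != 0.

(** If F took equal values at two points of [J], Rolle's theorem would give a zero of F' between
    them, hence in the interval [J]. *)
Lemma smooth1_on_inj u v : J u -> J v -> F u = F v -> u = v.
Proof.
wlog uv : u v / u < v.
  move=> H Ju Jv Fuv; have [uv|uv|//] := ltgtP u v; first exact: H.
  by apply/esym; exact: H.
move=> Ju Jv Fuv; have Jin w : u <= w -> w <= v -> J w.
  by move=> uw wv; apply: iJ Ju Jv _ _; apply/andP.
have [| |c] := Rolle uv _ _ Fuv.
- by move=> w; rewrite in_itv/= => /andP[/ltW uw /ltW wv]; exact: sF 0%N _ (Jin w uw wv).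
- apply: derivable_within_continuous => w; rewrite in_itv/= => /andP[uw wv].
  exact: sF 0%N _ (Jin w uw wv).
rewrite in_itv/= => /andP[/ltW uc /ltW cv] [_ F'c].
by have := F'0 (Jin c uc cv); rewrite derive1E F'c eqxx.
Qed.

Lemma differentiable_local_inverse (V : normedModType R) (f g : V -> R) (x : V) :
  (\forall y \near x, J (f y) /\ F (f y) = g y) -> differentiable g x ->
  differentiable f x.
Proof.
move=> fg dg; have [Jfx Ffx] := nbhs_singleton fg.
(* [G] is the inverse of [F] on [F(J)]; the default 0 is not met near [x], where [g y = F (f y)]
   lies in [F(J)]. *)
pose G y := xget 0 [set u | J u /\ F u = y].
have FK u : J u -> G (F u) = u.
  move=> Ju; have [Jv Fv] : [set v | J v /\ F v = F u] (G (F u)).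
    by apply: (@xgetPex _ 0 [set v | J v /\ F v = F u]); exists u.
  exact: smooth1_on_inj.
have JN u : J u -> \forall w \near u, J w by move=> Ju; exact: open_nbhs_nbhs.
have dG : is_derive (F (f x)) 1 G (F^`()%classic (f x))^-1.
  apply: (@is_derive_inverse _ F).
  - by apply: filterS (JN _ Jfx) => u; exact: FK.
  - apply: filterS (JN _ Jfx) => u Ju.
    by apply: differentiable_continuous; apply/derivable1_diffP; exact: sF 0%N _ Ju.
  - by rewrite derive1E; apply/derivableP; exact: sF 0%N _ Jfx.
  - exact: F'0.
apply: (near_eq_differentiable (f := G \o g)).
  by apply: filterS fg => y [Jfy fgy]; rewrite /= -fgy FK.
apply: differentiable_comp => //; apply/derivable1_diffP; rewrite -Ffx.
by case: dG.
Qed.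

Lemma smooth_on_local_inverse n (A : set 'rV[R]_n) (f g : 'rV[R]_n -> R) :
  open A -> (forall x, A x -> J (f x) /\ F (f x) = g x) ->
  smooth_on A g -> smooth_on A f.
Proof.
move=> oA fg sg; have df x : A x -> differentiable f x.
  move=> Ax; apply: differentiable_local_inverse (smooth_on_differentiable sg Ax).
  by apply: filterS fg _; exact: open_nbhs_nbhs.
have Jf x : A x -> J (f x) by move=> /fg[].
have sF' : smooth1_on J (F^`()%classic).
  by move=> m u Ju; rewrite -derive1Sn; exact: sF.
(* Bootstrap on the order through f_i = g_i / F'(f). *)
apply/smooth_onP; elim=> [|k IH]; split=> // i.
have F'f0 x : A x -> (F^`()%classic \o f) x != 0 by move=> Ax; exact/F'0/Jf.
have /smooth_onP/(_ k) := smooth_on_pderiv i sg.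
move=> /(CkM oA)/(_ (CkV oA F'f0 (Ck_comp1 oA sF' Jf IH))).
apply: Ck_eq => // x Ax /=.
rewrite -(pderiv_eq_on oA (f := F \o f)) => [|y /fg[]//|//].
rewrite pderiv_comp1//; last exact: df.
  by rewrite mulrAC mulfV ?mul1r//; exact: F'f0.
exact: sF 0%N _ (Jf _ Ax).
Qed.

End local_inverse.

(** * The two indices and the numbering of the jet coordinates *)

Lemma ord2P (i : 'I_2) : i = ord0 \/ i = ord_max.
Proof.
by case: i => [[|[|//]] i2]; [left|right]; exact: val_inj.
Qed.

Lemma rev_ord_max : rev_ord ord_max = ord0 :> 'I_2.
Proof. exact: val_inj. Qed.

(** As [rev_ord] exchanges the two indices, both sides are the mixed derivative f_12 in one order or
    the other. Writing the other index as [rev_ord i] treats Q and Q^* together. *)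
Lemma mixed_pderiv (Omega : set 'rV[R]_2) (f : 'rV[R]_2 -> R) (i j : 'I_2) x :
  open Omega -> smooth_on Omega f -> Omega x ->
  pderiv i (pderiv (rev_ord i) f) x = pderiv j (pderiv (rev_ord j) f) x.
Proof.
move=> oO sf Ox; have rev0 : rev_ord ord0 = ord_max :> 'I_2 by exact: val_inj.
have C := smooth_on_pderivC ord0 ord_max oO sf Ox.
case: (ord2P i) => ->; case: (ord2P j) => ->; rewrite ?rev0 ?rev_ord_max;
  [exact: erefl|exact: C|exact: esym C|exact: erefl].
Qed.

Lemma cxE (i : 'I_2) : cx i = i :> nat.
Proof. by rewrite inordK//; have := ltn_ord i; lia. Qed.

Lemma cuE : cu = 2%N :> nat.
Proof. by rewrite inordK. Qed.

Lemma cu1E (i : 'I_2) : cu1 i = (3 + i)%N :> nat.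
Proof. by rewrite inordK//; have := ltn_ord i; lia. Qed.

Lemma cu2E (i j : 'I_2) : cu2 i j = (5 + i + j)%N :> nat.
Proof. by rewrite inordK//; have := ltn_ord i; have := ltn_ord j; lia. Qed.

Definition coordE := (cxE, cuE, cu1E, cu2E).

Lemma cx_inj : injective cx.
Proof. by move=> i j /(congr1 (@nat_of_ord _)); rewrite !cxE => /val_inj. Qed.

Lemma cx_cu i : cx i != cu.
Proof. by rewrite -val_eqE/= !coordE; have := ltn_ord i; lia. Qed.

Lemma cx_cu1 i j : cx i != cu1 j.
Proof. by rewrite -val_eqE/= !coordE; have := ltn_ord i; lia. Qed.

Lemma cu1_eq i j : (cu1 i == cu1 j) = (i == j).
Proof. by rewrite -val_eqE/= !coordE eqn_add2l. Qed.

Lemma cu2C i j : cu2 i j = cu2 j i.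
Proof. by apply: val_inj; rewrite /= !coordE; lia. Qed.

(** For both values of [i] the position is 5 + i + (1 - i) = 6, that of u_12. *)
Lemma cu2_rev i : cu2 i (rev_ord i) = cu2 ord0 ord_max.
Proof. by apply: val_inj; rewrite /= !coordE/=; have := ltn_ord i; lia. Qed.

Lemma derive_entry n (j : 'I_n) (v x : 'rV[R]_n) :
  'D_v (fun y : 'rV[R]_n => y 0 j) x = v 0 j.
Proof.
have /(congr1 (fun M : 'rV[R]_n => M 0 j)) := derive_mx (@derivable_id R _ x v).
by rewrite derive_id mxE.
Qed.

Lemma pderiv_entry n (j l : 'I_n) (x : 'rV[R]_n) :
  pderiv l (fun y : 'rV[R]_n => y 0 j) x = (j == l)%:R.
Proof. by rewrite /pderiv derive_entry mxE eqxx. Qed.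

Lemma Ck_entry n (A : set 'rV[R]_n) (j : 'I_n) k : open A ->
  Ck k A (fun y : 'rV[R]_n => y 0 j).
Proof.
move=> oA; case: k => [|k].
  by split=> // x _; exact: differentiable_coord.
split=> [x _|l]; first exact: differentiable_coord.
by apply: (Ck_eq oA _ (Ck_cst oA k (j == l)%:R)) => x _; rewrite pderiv_entry.
Qed.

(** * Total derivatives, the manifold Q_(2) and the prolongation for shift operators *)

Section jets.
Context {Omega : set 'rV[R]_2} {J : set R}.
Implicit Types (zeta f : 'rV[R]_2 -> R) (p : jet R).

Notation bx p := (base_x (jet_base p)).

Lemma base_xE : base_x = colsub (widen_ord (isT : 2 <= 3)%N) :> ('rV[R]_3 -> 'rV[R]_2).
Proof. by apply/funext => y; apply/rowP => i; rewrite !mxE. Qed.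

(** Presents the passage from a jet to x as a coordinate projection, so that the results on [colsub]
    apply. *)
Lemma base_jetE : (fun p : jet R => bx p) = colsub cx.
Proof.
apply/funext => p; apply/rowP => i; rewrite !mxE; congr (p 0 _).
by apply: val_inj; rewrite /= cxE.
Qed.

Lemma jet_base_u p : jet_base p 0 ord_max = p 0 cu.
Proof. by rewrite mxE; congr (p 0 _); apply: val_inj; rewrite /= cuE. Qed.

Lemma jet_domP p : jet_dom Omega J p <-> Omega (bx p) /\ J (p 0 cu).
Proof. by rewrite -jet_base_u. Qed.

Lemma pderiv_cx zeta k p :
  pderiv (cx k) (fun q => zeta (bx q)) p = pderiv k zeta (bx p).
Proof.
have /= := congr1 (fun g => g p) (pderiv_colsub cx_inj zeta k).
by rewrite -base_jetE.
Qed.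

Lemma pderiv_notcx zeta (l : 'I_8) p : (forall k, cx k != l) ->
  pderiv l (fun q => zeta (bx q)) p = 0.
Proof.
move=> lx; have /= := congr1 (fun g => g p) (pderiv_colsub0 zeta lx).
by rewrite -base_jetE.
Qed.

Lemma differentiable_bx zeta p : differentiable zeta (bx p) ->
  differentiable (fun q => zeta (bx q)) p.
Proof.
move=> dz; apply: (@differentiable_comp _ _ _ _ (fun q : jet R => bx q)) => //.
by rewrite base_jetE; exact: differentiable_colsub.
Qed.

Lemma DtotB k (G H : jet R -> R) p : differentiable G p -> differentiable H p ->
  Dtot k (fun q => G q - H q) p = Dtot k G p - Dtot k H p.
Proof.
move=> dG dH; have dGH l : pderiv l (fun q => G q - H q) p = pderiv l G p - pderiv l H p.
  by rewrite (pderivD _ dG (differentiableN dH)) pderivN.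
rewrite /Dtot !dGH !big_ord_recl !big_ord0 !dGH; clear.
by move: (pderiv _ _ _) (pderiv _ _ _) (pderiv _ _ _) (pderiv _ _ _)
  (pderiv _ _ _) (pderiv _ _ _) (pderiv _ _ _) (pderiv _ _ _) => *; ring.
Qed.

Lemma Dtot_bx k zeta p : Dtot k (fun q => zeta (bx q)) p = pderiv k zeta (bx p).
Proof.
rewrite /Dtot pderiv_cx pderiv_notcx ?mulr0 ?addr0; last by move=> l; exact: cx_cu.
rewrite big1 ?addr0// => j _; rewrite pderiv_notcx ?mulr0// => l; exact: cx_cu1.
Qed.

Lemma Dtot_cu1 k i p : Dtot k (fun q => q 0 (cu1 i)) p = p 0 (cu2 k i).
Proof.
rewrite /Dtot !pderiv_entry.
have -> : (cu1 i == cx k) = false by rewrite eq_sym; apply/negbTE/cx_cu1.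
have -> : (cu1 i == cu) = false by apply/negbTE; rewrite -val_eqE/= !coordE.
rewrite mulr0 !add0r (bigD1 i)//= pderiv_entry eqxx mulr1 big1 ?addr0// => j ji.
by rewrite pderiv_entry cu1_eq eq_sym (negbTE ji) mulr0.
Qed.

Lemma Dtot_cst k (c : R) p : Dtot k (fun=> c) p = 0.
Proof. by rewrite (Dtot_bx k (cst c)) /pderiv derive_cst. Qed.

Lemma vf_char_shift i zeta p :
  vf_char (vf_shift i zeta) p = zeta (bx p) - p 0 (cu1 i).
Proof.
rewrite /vf_char/= (bigD1 i)//= eqxx mul1r big1 ?addr0// => j /negbTE ->.
by rewrite mul0r.
Qed.

(** The characteristic is zeta(x) - u_i, and D_k turns it into zeta_k(x) - u_ik. *)
Lemma char_manifold_shift i zeta p : differentiable zeta (bx p) ->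
  char_manifold (vf_shift i zeta) p <->
  p 0 (cu1 i) = zeta (bx p) /\ forall k, p 0 (cu2 i k) = pderiv k zeta (bx p).
Proof.
move=> dz; have DE k : Dtot k (vf_char (vf_shift i zeta)) p =
    pderiv k zeta (bx p) - p 0 (cu2 i k).
  rewrite (_ : vf_char _ = fun q => zeta (bx q) - q 0 (cu1 i)); last first.
    by apply/funext => q; rewrite vf_char_shift.
  rewrite DtotB; [|exact: differentiable_bx|exact: differentiable_coord].
  by rewrite Dtot_bx Dtot_cu1 cu2C.
rewrite /char_manifold/= vf_char_shift.
split=> -[/eqP + D]; rewrite ?subr_eq0.
  move=> /eqP ->; split=> // k; apply/esym/eqP; rewrite -subr_eq0 -DE.
  exact/eqP.
by move=> /eqP ->; rewrite subrr; split=> // k; rewrite DE D subrr.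
Qed.

(** The xi^k are constant and so have zero total derivatives; eta = zeta depends on x alone. The
    equality is one of functions because [prol2] differentiates it again. *)
Lemma prol1_shift i zeta k :
  prol1 (vf_shift i zeta) k = fun p => pderiv k zeta (bx p).
Proof.
apply/funext => p; rewrite /prol1 big1 ?subr0 => [|j _].
  exact: Dtot_bx.
by rewrite (Dtot_cst k (j == i)%:R) mulr0.
Qed.

Lemma prol2_shift i zeta k l p :
  prol2 (vf_shift i zeta) k l p = pderiv l (pderiv k zeta) (bx p).
Proof.
rewrite /prol2 prol1_shift Dtot_bx big1 ?subr0// => j _.
by rewrite (Dtot_cst l (j == i)%:R) mulr0.
Qed.

Lemma pderiv_wave (F : R -> R) (l : 'I_8) p : derivable F (p 0 cu) 1 ->
  pderiv l (wave_eq F) p =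
  (cu2 ord0 ord_max == l)%:R - F^`()%classic (p 0 cu) * (cu == l)%:R.
Proof.
move=> dF; have dcu := @differentiable_coord R _ _ p 0 cu.
have dFu : differentiable (F \o (fun q : jet R => q 0 cu)) p.
  by apply: differentiable_comp => //; apply/derivable1_diffP.
rewrite (pderivD _ (differentiable_coord p 0 (cu2 ord0 ord_max))
  (differentiableN dFu)) (pderivN _ dFu) pderiv_comp1//.
by rewrite !pderiv_entry.
Qed.

(** L depends on u and u_12 only, so two terms of the prolongation survive, with coefficients zeta
    and zeta_12. *)
Lemma prolong_wave i zeta (F : R -> R) p : derivable F (p 0 cu) 1 ->
  prolong (vf_shift i zeta) (wave_eq F) p =
  pderiv ord_max (pderiv ord0 zeta) (bx p) - zeta (bx p) * F^`()%classic (p 0 cu).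
Proof.
move=> dF; have dW l := pderiv_wave l dF.
have W0 l : l != cu -> l != cu2 ord0 ord_max -> pderiv l (wave_eq F) p = 0.
  move=> lu l2; rewrite dW [cu == l]eq_sym (negbTE lu) [_ == l]eq_sym (negbTE l2).
  by rewrite mulr0 subr0.
have -> : prolong (vf_shift i zeta) (wave_eq F) p =
    zeta (bx p) * pderiv cu (wave_eq F) p +
    prol2 (vf_shift i zeta) ord0 ord_max p * pderiv (cu2 ord0 ord_max) (wave_eq F) p.
  rewrite /prolong big1 ?add0r => [|j _]; last first.
    rewrite W0 ?mulr0 ?cx_cu//.
    by rewrite -val_eqE/= !coordE; have := ltn_ord j; lia.
  rewrite [X in _ + X + _]big1 ?addr0 => [|j _]; last first.
    rewrite W0 ?mulr0// -val_eqE/= !coordE//.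
    by have := ltn_ord j; rewrite /=; lia.
  (* Of the index pairs (0,0), (0,1) and (1,1) of the double sum, only (0,1) meets a coordinate on
     which L depends. *)
  congr (_ + _); rewrite (bigD1 ord0)//= [X in _ + X = _]big1 ?addr0 => [|j j0].
    rewrite (bigD1 ord_max)//= big1 ?addr0// => k km.
    have [->|kE] := ord2P k; last by rewrite kE eqxx in km.
    by rewrite W0 ?mulr0// -val_eqE/= !coordE.
  have [jE|->] := ord2P j; first by rewrite jE eqxx in j0.
  rewrite big1// => k k1; have [kE|->] := ord2P k; first by rewrite kE in k1.
  by rewrite W0 ?mulr0// -val_eqE/= !coordE.
rewrite !dW prol2_shift !eqxx.
have -> : (cu2 ord0 ord_max == cu) = false by apply/negbTE; rewrite -val_eqE/= !coordE.
rewrite [cu == _]eq_sym.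
have -> : (cu2 ord0 ord_max == cu) = false by apply/negbTE; rewrite -val_eqE/= !coordE.
by rewrite mulr1 mulr0 subr0 sub0r mulr1 mulrN addrC.
Qed.

End jets.

(** * Reduction operators of shift form, invariant solutions and co-order *)

Section shift_operator.
Context {Omega : set 'rV[R]_2} {J : set R} {F : R -> R}.
Hypotheses (oO : open Omega) (oJ : open J) (iJ : is_interval J).
Hypotheses (sF : smooth1_on J F) (F'0 : forall u, J u -> F^`()%classic u != 0).
Implicit Types (zeta f : 'rV[R]_2 -> R) (p : jet R) (i : 'I_2).

Notation bx p := (base_x (jet_base p)).

Lemma open_base_dom : open (base_dom Omega J).
Proof.
apply: openI; apply: open_comp => // y _; last exact: coord_continuous.
by rewrite base_xE; exact: colsub_continuous.
Qed.

Lemma open_jet_dom : open (jet_dom Omega J).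
Proof.
apply: open_comp open_base_dom => p _.
rewrite (_ : jet_base = colsub (widen_ord (isT : 3 <= 8)%N)).
  exact: colsub_continuous.
by apply/funext => q; apply/rowP => k; rewrite !mxE.
Qed.

(** One direction is a pullback along the projection to x; the other restricts to the slice of
    constant [u], which lies in the domain because [u] is in [J]. *)
Lemma smooth_on_base_xP zeta u : J u ->
  smooth_on (base_dom Omega J) (zeta \o base_x) <-> smooth_on Omega zeta.
Proof.
move=> Ju; pose s : 'I_2 -> 'I_3 := widen_ord (isT : 2 <= 3)%N.
have s_inj : injective s by move=> k l kl; apply: val_inj; exact: (congr1 val kl).
pose P : 'M[R]_(2, 3) := \matrix_(k, l) (s k == l)%:R.
(* The section x |-> (x, u): [P] appends a zero coordinate, which the second summand sets to [u]. *)
pose t (x : 'rV[R]_2) : 'rV[R]_3 := x *m P + u *: delta_mx 0 ord_max.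
have s_max k : (s k == ord_max) = false.
  by apply/negbTE; rewrite -val_eqE/=; have := ltn_ord k; lia.
have sP : colsub s P = 1%:M by apply/matrixP => k l; rewrite !mxE (inj_eq s_inj).
have tK : cancel t (colsub s).
  move=> x; rewrite /t linearD/= -mulmx_colsub sP mulmx1.
  rewrite [X in _ + X](_ : _ = 0) ?addr0//.
  by apply/rowP => k; rewrite !mxE/= s_max mulr0.
have dt x : differentiable t x.
  apply: differentiableD => //; first exact: (differentiable_mulmxr P x).
have t_max x : t x 0 ord_max = u.
  rewrite !mxE !eqxx mulr1 big1 ?add0r// => k _.
  by rewrite !mxE s_max mulr0.
rewrite base_xE; split=> [/smooth_onP sz|/smooth_onP sz]; apply/smooth_onP => k.
  apply: (Ck_colsub_inv s_inj dt tK _ (sz k)) => x Ox.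
  by split; [rewrite base_xE tK|rewrite t_max].
by apply: (Ck_colsub s_inj open_base_dom _ (sz k)) => y []; rewrite base_xE.
Qed.

(* The point of Q_(2) over (x, u): there u_ik = zeta_k, so the coordinate of
   index 5 + m is zeta_(m - i); the entries left free by Q_(2) (u_o and u_oo,
   for o the index other than i) receive junk values. *)
Definition shift_jet i zeta (x : 'rV[R]_2) (u : R) : jet R :=
  \row_(k < 8) [:: x 0 ord0; x 0 ord_max; u; zeta x; zeta x;
    pderiv (inord (0 - i)) zeta x; pderiv (inord (1 - i)) zeta x;
    pderiv (inord (2 - i)) zeta x]`_k.

Lemma shift_jet_base i zeta x u : bx (shift_jet i zeta x u) = x.
Proof.
by apply/rowP => k; rewrite !mxE/=; case: (ord2P k) => ->.
Qed.

Lemma shift_jet_u i zeta x u : shift_jet i zeta x u 0 cu = u.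
Proof. by rewrite mxE cuE. Qed.

Lemma shift_jet_dom i zeta x u : Omega x -> J u ->
  jet_dom Omega J (shift_jet i zeta x u).
Proof. by move=> Ox Ju; apply/jet_domP; rewrite shift_jet_base shift_jet_u. Qed.

Lemma char_shift_jet i zeta x u : differentiable zeta x ->
  char_manifold (vf_shift i zeta) (shift_jet i zeta x u).
Proof.
move=> dz; apply/char_manifold_shift; rewrite shift_jet_base//.
split=> [|k].
  by rewrite mxE cu1E; case: (ord2P i) => ->.
(* With [k] in this form the right-hand side matches the entry that [shift_jet] stores at position 5
   + i + k. *)
have kE : k = inord (i + k - i) by rewrite addKn inord_val.
by rewrite mxE cu2E [in RHS]kE; case: (ord2P i) => ->; case: (ord2P k) => ->.
Qed.

Lemma jet2_base f x : bx (jet2 f x) = x.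
Proof. by apply/rowP => k; rewrite !mxE/=; case: (ord2P k) => ->. Qed.

Lemma jet2_cu1 f x i : jet2 f x 0 (cu1 i) = pderiv i f x.
Proof. by rewrite mxE cu1E; case: (ord2P i) => ->. Qed.

Lemma wave_jet2 f x :
  wave_eq F (jet2 f x) = pderiv ord0 (pderiv ord_max f) x - F (f x).
Proof. by rewrite /wave_eq !mxE cu2E cuE. Qed.

Lemma invariant_shiftP i zeta f : invariant_fun Omega (vf_shift i zeta) f <->
  forall x, Omega x -> zeta x = pderiv i f x.
Proof.
split=> H x Ox; have := H x Ox; rewrite vf_char_shift jet2_base jet2_cu1.
  by move/eqP; rewrite subr_eq0 => /eqP.
by move=> ->; rewrite subrr.
Qed.

(** The derivative along [i] is put innermost because [pderiv i f] is the zeta attached to [f]. *)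
Lemma solution_waveP i f : solution Omega J (wave_eq F) f <->
  smooth_on Omega f /\
  forall x, Omega x -> J (f x) /\ pderiv (rev_ord i) (pderiv i f) x = F (f x).
Proof.
have mixed x : smooth_on Omega f -> Omega x ->
    pderiv ord0 (pderiv ord_max f) x = pderiv (rev_ord i) (pderiv i f) x.
  move=> sf Ox; rewrite -[ord_max](rev_ordK).
  have -> : ord0 = rev_ord ord_max :> 'I_2 by exact: val_inj.
  have := mixed_pderiv (rev_ord ord_max) (rev_ord i) oO sf Ox.
  by rewrite !rev_ordK.
split=> -[sf H]; split=> // x Ox; have [Jf] := H x Ox; rewrite wave_jet2 mixed//.
  by move/eqP; rewrite subr_eq0 => /eqP.
by move=> ->; rewrite subrr.
Qed.

Lemma wave_char_manifold i zeta p : differentiable zeta (bx p) ->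
  char_manifold (vf_shift i zeta) p ->
  wave_eq F p = pderiv (rev_ord i) zeta (bx p) - F (p 0 cu).
Proof.
by move=> dz /(char_manifold_shift _ dz)[_ D]; rewrite /wave_eq -(cu2_rev i) D.
Qed.

(** Eliminates the jets: on Q_(2) both L and its prolongation reduce to functions of (x, u), and
    [shift_jet] provides a point of Q_(2) over every (x, u) of the domain. *)
Lemma reduction_shiftP i zeta : Omega !=set0 ->
  reduction_operator Omega J (wave_eq F) (vf_shift i zeta) <->
  [/\ smooth_on Omega zeta,
      forall x, Omega x -> exists2 u, J u & F u = pderiv (rev_ord i) zeta x &
      forall x u, Omega x -> J u -> F u = pderiv (rev_ord i) zeta x ->
        pderiv i (pderiv (rev_ord i) zeta) x = zeta x * F^`()%classic u].
Proof.
move=> [x0 Ox0].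
have mixed x : smooth_on Omega zeta -> Omega x ->
    pderiv i (pderiv (rev_ord i) zeta) x = pderiv ord_max (pderiv ord0 zeta) x.
  move=> sz Ox; rewrite (mixed_pderiv i ord_max oO sz Ox).
  by rewrite rev_ord_max.
split=> [[[sz _] _ ex red]|[sz ex red]].
  (* A point over [x0] yields an element of [J]; for empty [J] smoothness on [base_dom Omega J]
     would say nothing about [zeta]. *)
  have [p0 [/jet_domP[_ Jp0] _ _ _]] := ex _ Ox0.
  have {}sz : smooth_on Omega zeta by exact/(smooth_on_base_xP _ Jp0).
  have dz x : Omega x -> differentiable zeta x by exact: smooth_on_differentiable.
  split=> // [x Ox|x u Ox Ju Fu].
    have [p [/jet_domP[Op Jp] px Lp Qp]] := ex x Ox.
    exists (p 0 cu) => //; apply/esym/eqP; rewrite -subr_eq0 -px.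
    by rewrite -wave_char_manifold ?Lp//; exact: dz.
  have Qp := char_shift_jet i u (dz _ Ox).
  have := red _ (shift_jet_dom i zeta Ox Ju).
  rewrite prolong_wave; last by rewrite shift_jet_u; exact: sF 0%N _ Ju.
  rewrite shift_jet_base shift_jet_u.
  rewrite (wave_char_manifold _ Qp) ?shift_jet_base ?shift_jet_u; last exact: dz.
  rewrite Fu subrr => /(_ erefl Qp)/eqP.
  by rewrite subr_eq0 mixed// => /eqP.
have dz x : Omega x -> differentiable zeta x by exact: smooth_on_differentiable.
have [u0 Ju0 _] := ex _ Ox0.
split.
- split; first exact/(smooth_on_base_xP _ Ju0).
  by move=> j; apply/smooth_onP => k; exact: Ck_cst open_base_dom _ _.
- by move=> y _; exists i; rewrite /= eqxx oner_neq0.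
- move=> x Ox; have [u Ju Fu] := ex x Ox; exists (shift_jet i zeta x u).
  have Qp := char_shift_jet i u (dz _ Ox).
  split=> //; [exact: shift_jet_dom|exact: shift_jet_base|].
  rewrite (wave_char_manifold _ Qp) ?shift_jet_base ?shift_jet_u; last exact: dz.
  by rewrite Fu subrr.
- move=> p /jet_domP[Op Jp] Lp Qp; rewrite prolong_wave; last exact: sF 0%N _ Jp.
  have /eqP := wave_char_manifold (dz _ Op) Qp; rewrite Lp eq_sym subr_eq0 => /eqP Fp.
  by rewrite -mixed// (red _ (p 0 cu))// subrr.
Qed.

Lemma reduction_of_solution i f : Omega !=set0 -> solution Omega J (wave_eq F) f ->
  reduction_operator Omega J (wave_eq F) (vf_shift i (pderiv i f)).
Proof.
move=> O0 /(solution_waveP i)[sf fP]; apply/reduction_shiftP => //.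
split=> [|x Ox|x u Ox Ju Fu].
- exact: smooth_on_pderiv.
- by exists (f x); have [] := fP x Ox.
have [Jf fE] := fP x Ox.
(* By injectivity of F, the only value of u over x on the intersection is f(x), so the condition
   need only be checked along the graph of f. *)
have -> : u = f x by apply: (smooth1_on_inj iJ sF F'0) => //; rewrite Fu fE.
rewrite (pderiv_eq_on oO (g := F \o f)) => [|y /fP[_ ->]//|//].
rewrite pderiv_comp1; first by rewrite mulrC.
- exact: sF 0%N _ Jf.
- exact: smooth_on_differentiable sf Ox.
Qed.

Lemma solution_of_reduction i zeta : Omega !=set0 ->
  reduction_operator Omega J (wave_eq F) (vf_shift i zeta) ->
  exists f, solution Omega J (wave_eq F) f /\
    invariant_fun Omega (vf_shift i zeta) f.
Proof.
move=> O0 /(reduction_shiftP _ _ O0)[sz ex red].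
(* Solvability of F(u) = zeta_o(x) over all of [Omega] keeps the default 0 from being taken
   there. *)
pose f x := xget 0 [set u | J u /\ F u = pderiv (rev_ord i) zeta x].
have fP x : Omega x -> J (f x) /\ F (f x) = pderiv (rev_ord i) zeta x.
  move=> Ox; apply: (@xgetPex _ 0 [set u | J u /\ F u = pderiv (rev_ord i) zeta x]).
  by have [u Ju Fu] := ex x Ox; exists u.
have sf : smooth_on Omega f.
  exact: (smooth_on_local_inverse oJ iJ sF F'0 oO fP (smooth_on_pderiv _ sz)).
have fz x : Omega x -> zeta x = pderiv i f x.
  move=> Ox; have [Jf Ff] := fP x Ox; have := red _ _ Ox Jf Ff.
  (* The reduction condition now reads F'(f) f_i = zeta F'(f), and F'(f) cancels. *)
  rewrite -(pderiv_eq_on oO (f := F \o f)) => [|y /fP[_ <-]//|//].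
  rewrite pderiv_comp1; [|exact: sF 0%N _ Jf|exact: smooth_on_differentiable sf Ox].
  by rewrite mulrC => /(mulIf (F'0 Jf)).
exists f; split; last exact/invariant_shiftP.
apply/(solution_waveP i); split=> // x Ox; have [Jf Ff] := fP x Ox.
by split=> //; rewrite Ff; apply: (pderiv_eq_on oO) => // y Oy; rewrite fz.
Qed.

(** Invariance gives f_i = zeta = g_i. The equation then gives F(f) = zeta_o = F(g), and injectivity
    of F leaves no freedom of integration. *)
Lemma invariant_solution_unique i zeta f g :
  solution Omega J (wave_eq F) f -> invariant_fun Omega (vf_shift i zeta) f ->
  solution Omega J (wave_eq F) g -> invariant_fun Omega (vf_shift i zeta) g ->
  forall x, Omega x -> g x = f x.
Proof.
move=> /(solution_waveP i)[sf fP] /invariant_shiftP fz.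
move=> /(solution_waveP i)[sg gP] /invariant_shiftP gz x Ox.
have [[Jf Ff] [Jg Fg]] := (fP x Ox, gP x Ox).
apply: (smooth1_on_inj iJ sF F'0) => //; rewrite -Ff -Fg.
by apply: (pderiv_eq_on oO) => // y Oy; rewrite -fz// gz.
Qed.

(** Rules out co-order -1: L vanishing on Q_(2) would force F to be constant on [J]. *)
Lemma not_constant_on u0 : J u0 -> ~ exists c, forall u, J u -> F u = c.
Proof.
move=> Ju0 [c Fc]; have /negP := F'0 Ju0; apply.
rewrite derive1E (@near_eq_derive _ _ _ _ (cst c)) ?derive_cst//.
by apply: filterS Fc _; exact: open_nbhs_nbhs.
Qed.

Lemma singularity_coorder_shift i zeta : Omega !=set0 ->
  reduction_operator Omega J (wave_eq F) (vf_shift i zeta) ->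
  singularity_coorder Omega J (wave_eq F) (vf_shift i zeta) 0.
Proof.
move=> [x0 Ox0] /reduction_shiftP[|sz ex _]; first by exists x0.
have [u0 Ju0 _] := ex _ Ox0.
have dz x : Omega x -> differentiable zeta x by exact: smooth_on_differentiable.
(* Used twice: against any candidate of order -1, and to show that the candidate exhibited below has
   order exactly 0. *)
have nz : ~ forall p, jet_dom Omega J p -> char_manifold (vf_shift i zeta) p ->
    wave_eq F p = 0.
  move=> W0; apply: (not_constant_on Ju0); exists (pderiv (rev_ord i) zeta x0) => u Ju.
  have Qp := char_shift_jet i u (dz _ Ox0).
  have /eqP := W0 _ (shift_jet_dom i zeta Ox0 Ju) Qp.
  rewrite (wave_char_manifold _ Qp) ?shift_jet_base ?shift_jet_u; last exact: dz.
  by rewrite subr_eq0 => /eqP.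
have WG p : jet_dom Omega J p -> char_manifold (vf_shift i zeta) p ->
    wave_eq F p = pderiv (rev_ord i) zeta (bx p) - F (p 0 cu).
  by move=> /jet_domP[Op _]; apply: wave_char_manifold; exact: dz.
split=> [|G [n//|n] [_ [_ G0 _] GW]]; last first.
  by exfalso; apply: nz => p Dp Qp; rewrite GW// G0.
exists (fun p => pderiv (rev_ord i) zeta (bx p) - F (p 0 cu)); split=> //.
- apply/smooth_onP => k.
  have Cz : Ck k (jet_dom Omega J) (fun p => pderiv (rev_ord i) zeta (bx p)).
    have /smooth_onP/(_ k) Cz := smooth_on_pderiv (rev_ord i) sz.
    have := Ck_colsub cx_inj open_jet_dom _ Cz; rewrite -base_jetE; apply.
    by move=> p /jet_domP[].
  apply: (CkD open_jet_dom Cz (CkN open_jet_dom _)).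
  apply: (Ck_comp1 open_jet_dom sF _ (Ck_entry cu k open_jet_dom)).
  by move=> p /jet_domP[].
- rewrite /has_order -[0 : int]/(Posz 0).
  split=> [//|p q _ _ pq|[//|n] _ _ G0]; last first.
    by apply: nz => p Dp Qp; rewrite WG// G0.
  (* The candidate factors through x_1, x_2 and u, the coordinates of order 0, on which [p] and [q]
     agree. *)
  have -> : bx p = bx q.
    rewrite -![bx _]/((fun r : jet R => bx r) _) base_jetE.
    apply/rowP => k; rewrite !mxE; apply: pq; rewrite /coord_order cxE.
    by case: (ord2P k) => ->.
  by rewrite pq// /coord_order cuE.
Qed.

End shift_operator.

End Calculus.

(* i = ord_max gives Q = d/dx_2 + zeta(x) d/du, and i = ord0 gives
   Q^* = d/dx_1 + zeta^*(x) d/du; functions on Omega are compared on Omega. *)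
Theorem theorem4 (R : realType) (J : set R) (F : R -> R)
    (Omega : set 'rV[R]_2)
    (openJ : open J) (itvJ : is_interval J)
    (smoothF : smooth1_on J F) (F'neq0 : forall u, J u -> (F^`())%classic u != 0)
    (openOmega : open Omega) (Omega0 : Omega !=set0) (i : 'I_2) :
  [/\ forall f : 'rV[R]_2 -> R, solution Omega J (wave_eq F) f ->
        exists zeta : 'rV[R]_2 -> R,
          [/\ reduction_operator Omega J (wave_eq F) (vf_shift i zeta),
              invariant_fun Omega (vf_shift i zeta) f &
              forall zeta' : 'rV[R]_2 -> R,
                reduction_operator Omega J (wave_eq F) (vf_shift i zeta') ->
                invariant_fun Omega (vf_shift i zeta') f ->
                forall x, Omega x -> zeta' x = zeta x],
      forall zeta : 'rV[R]_2 -> R,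
        reduction_operator Omega J (wave_eq F) (vf_shift i zeta) ->
        exists f : 'rV[R]_2 -> R,
          [/\ solution Omega J (wave_eq F) f,
              invariant_fun Omega (vf_shift i zeta) f &
              forall g : 'rV[R]_2 -> R,
                solution Omega J (wave_eq F) g ->
                invariant_fun Omega (vf_shift i zeta) g ->
                forall x, Omega x -> g x = f x] &
      forall zeta : 'rV[R]_2 -> R,
        reduction_operator Omega J (wave_eq F) (vf_shift i zeta) ->
        singularity_coorder Omega J (wave_eq F) (vf_shift i zeta) 0].
Proof.
split=> [f fS|zeta rz|zeta rz].
- exists (pderiv i f); split; first exact: reduction_of_solution.
    exact/invariant_shiftP.
  (* Invariance of [f] alone determines the operator: zeta' = f_i on [Omega]. *)
  by move=> zeta' _ /invariant_shiftP.
- have [f [fS fI]] := solution_of_reduction openOmega openJ itvJ smoothF F'neq0 Omega0 rz.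
  exists f; split=> // g gS gI.
  exact: (invariant_solution_unique openOmega itvJ smoothF F'neq0 fS fI gS gI).
- exact: (singularity_coorder_shift openOmega openJ smoothF F'neq0 Omega0 rz).
Qed.
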